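(* Let $\mathsf{A}=a_0+a_1\mathbf{e}_1+a_2\mathbf{e}_2+a_3\mathbf{e}_3+a_{12}\mathbf{e}_{12}+a_{13}\mathbf{e}_{13}+a_{23}\mathbf{e}_{23}+a_{123}I$ be an arbitrary element of the real Clifford algebra $\mathit{Cl}_{2,1}$ (all coefficients real). Define the real numbers (which may be of either sign; $a_\pm^2$ is just notation) $$a_{+}^2=-(a_3-a_{12})^2+(a_2-a_{13})^2+(a_1+a_{23})^2,\qquad a_{-}^2=-(a_3+a_{12})^2+(a_2+a_{13})^2+(a_1-a_{23})^2,$$ and for real $x$ the functions $$\mathrm{si}(x)=\begin{cases}\frac{\sinh\sqrt{x}}{\sqrt{x}},&x>0,\\ \frac{\sin\sqrt{-x}}{\sqrt{-x}},&x<0,\\ 1,&x=0,\end{cases}\qquad \mathrm{co}(x)=\begin{cases}\cosh\sqrt{x},&x>0,\\ \cos\sqrt{-x},&x<0,\\ 1,&x=0.\end{cases}$$ Then $\exp(\mathsf{A})=b_0+b_1\mathbf{e}_1+b_2\mathbf{e}_2+b_3\mathbf{e}_3+b_{12}\mathbf{e}_{12}+b_{13}\mathbf{e}_{13}+b_{23}\mathbf{e}_{23}+b_{123}I$, where $$\begin{aligned} b_{0}&=\tfrac12 e^{a_0}\bigl(e^{a_{123}}\,\mathrm{co}(a_{+}^2)+e^{-a_{123}}\,\mathrm{co}(a_{-}^2)\bigr),\\ b_{123}&=\tfrac12 e^{a_0}\bigl(e^{a_{123}}\,\mathrm{co}(a_{+}^2)-e^{-a_{123}}\,\mathrm{co}(a_{-}^2)\bigr),\\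 b_{1}&=\tfrac12 e^{a_0}\bigl(e^{a_{123}}(a_1+a_{23})\,\mathrm{si}(a_{+}^2)+e^{-a_{123}}(a_1-a_{23})\,\mathrm{si}(a_{-}^2)\bigr),\\ b_{2}&=\tfrac12 e^{a_0}\bigl(e^{a_{123}}(a_2-a_{13})\,\mathrm{si}(a_{+}^2)+e^{-a_{123}}(a_2+a_{13})\,\mathrm{si}(a_{-}^2)\bigr),\\ b_{3}&=\tfrac12 e^{a_0}\bigl(e^{a_{123}}(a_3-a_{12})\,\mathrm{si}(a_{+}^2)+e^{-a_{123}}(a_3+a_{12})\,\mathrm{si}(a_{-}^2)\bigr),\\ b_{12}&=\tfrac12 e^{a_0}\bigl(-e^{a_{123}}(a_3-a_{12})\,\mathrm{si}(a_{+}^2)+e^{-a_{123}}(a_3+a_{12})\,\mathrm{si}(a_{-}^2)\bigr),\\ b_{13}&=\tfrac12 e^{a_0}\bigl(-e^{a_{123}}(a_2-a_{13})\,\mathrm{si}(a_{+}^2)+e^{-a_{123}}(a_2+a_{13})\,\mathrm{si}(a_{-}^2)\bigr),\\ b_{23}&=\tfrac12 e^{a_0}\bigl(e^{a_{123}}(a_1+a_{23})\,\mathrm{si}(a_{+}^2)-e^{-a_{123}}(a_1-a_{23})\,\mathrm{si}(a_{-}^2)\bigr). \end{aligned}$$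
   Context: $\mathit{Cl}_{2,1}$ is the real associative unital algebra (of dimension 8) generated by $\mathbf{e}_1,\mathbf{e}_2,\mathbf{e}_3$ with $\mathbf{e}_i\mathbf{e}_j+\mathbf{e}_j\mathbf{e}_i=0$ for $i\neq j$, $\mathbf{e}_1^2=\mathbf{e}_2^2=1$ and $\mathbf{e}_3^2=-1$. Its basis is $\{1,\mathbf{e}_1,\mathbf{e}_2,\mathbf{e}_3,\mathbf{e}_{12},\mathbf{e}_{13},\mathbf{e}_{23},\mathbf{e}_{123}=I\}$, where $\mathbf{e}_{ij}=\mathbf{e}_i\mathbf{e}_j$ for $i<j$ and $I=\mathbf{e}_1\mathbf{e}_2\mathbf{e}_3$. The exponential is $\exp(\mathsf{A})=\sum_{k\ge0}\mathsf{A}^k/k!$ with respect to the algebra (geometric) product. *)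

(* Defs.v *)
From HB Require Import structures.
From mathcomp Require Import all_boot all_order all_algebra.
From mathcomp Require Import all_classical all_reals all_analysis.
From mathcomp Require Import ring.
Set Implicit Arguments.
Unset Strict Implicit.
Unset Printing Implicit Defensive.
Import Order.TTheory GRing.Theory Num.Theory.
Import numFieldNormedType.Exports.
Local Open Scope classical_set_scope.
Local Open Scope ring_scope.

(* Blades are numbered by bit masks: e_1^a e_2^b e_3^c has number a + 2b + 4c.
   The product of the blades numbered i and j is, up to a sign, the blade
   whose number is the bitwise exclusive or of i and j. *)
Definition bit1 (i : 'I_8) : bool := odd i.
Definition bit2 (i : 'I_8) : bool := odd i./2.
Definition bit3 (i : 'I_8) : bool := odd i./2./2.

Lemma blade_subproof (a b c : bool) : (a + b.*2 + c.*2.*2 < 8)%N.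
Proof. by case: a; case: b; case: c. Qed.

Definition blade (a b c : bool) : 'I_8 := Ordinal (blade_subproof a b c).

Definition blade_xor (i j : 'I_8) : 'I_8 :=
  blade (bit1 i (+) bit1 j) (bit2 i (+) bit2 j) (bit3 i (+) bit3 j).

(* The first three terms count the transpositions of distinct generators that
   sort the product of the two blades; the last one comes from e_3 ^ 2 = -1. *)
Definition blade_sign (i j : 'I_8) : bool :=
  (bit2 i && bit1 j) (+) (bit3 i && bit1 j) (+) (bit3 i && bit2 j)
  (+) (bit3 i && bit3 j).

(* The Clifford algebra Cl_{2,1}, with the topology of R^8. *)
Definition Cl21 (R : realType) : Type := 'rV[R]_8.

HB.instance Definition _ (R : realType) := Vector.copy (Cl21 R) 'rV[R]_8.
HB.instance Definition _ (R : realType) :=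
  NormedModule.copy (Cl21 R) 'rV[R]_8.
HB.instance Definition _ (R : realType) := Complete.copy (Cl21 R) 'rV[R]_8.

Lemma bladeK (i : 'I_8) : blade (bit1 i) (bit2 i) (bit3 i) = i.
Proof. by apply/val_inj; case: i; do 8?[case=> //]. Qed.

Lemma bit1_blade (a b c : bool) : bit1 (blade a b c) = a.
Proof. by case: a; case: b; case: c. Qed.

Lemma bit2_blade (a b c : bool) : bit2 (blade a b c) = b.
Proof. by case: a; case: b; case: c. Qed.

Lemma bit3_blade (a b c : bool) : bit3 (blade a b c) = c.
Proof. by case: a; case: b; case: c. Qed.

Definition bit_bladeE := (bit1_blade, bit2_blade, bit3_blade).

Lemma blade_xorK (i : 'I_8) : involutive (blade_xor i).
Proof. by move=> j; rewrite /blade_xor !bit_bladeE !addKb bladeK. Qed.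

Lemma blade_xorC (i j : 'I_8) : blade_xor i j = blade_xor j i.
Proof. by rewrite /blade_xor; congr blade; rewrite addbC. Qed.

Lemma blade_xorA (i j k : 'I_8) :
  blade_xor i (blade_xor j k) = blade_xor (blade_xor i j) k.
Proof. by rewrite /blade_xor !bit_bladeE !addbA. Qed.

Lemma blade_sign_cocycle (i j k : 'I_8) :
  blade_sign i j (+) blade_sign (blade_xor i j) k =
  blade_sign j k (+) blade_sign i (blade_xor j k).
Proof.
rewrite /blade_sign /blade_xor !bit_bladeE.
by case: (bit1 i); case: (bit2 i); case: (bit3 i);
   case: (bit1 j); case: (bit2 j); case: (bit3 j);
   case: (bit1 k); case: (bit2 k); case: (bit3 k).
Qed.

Section Cl21_algebra.
Variable R : realType.
Implicit Types A B C : Cl21 R.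

Definition Cl21_blade (i : 'I_8) : Cl21 R := delta_mx 0 i.

Definition Cl21_mul A B : Cl21 R :=
  \sum_(i < 8) \sum_(j < 8)
    ((-1) ^+ blade_sign i j * A 0 i * B 0 j) *: Cl21_blade (blade_xor i j).

Lemma Cl21_mulE A B (k : 'I_8) :
  Cl21_mul A B 0 k = \sum_(i < 8)
    (-1) ^+ blade_sign i (blade_xor i k) * A 0 i * B 0 (blade_xor i k).
Proof.
rewrite /Cl21_mul summxE; apply: eq_bigr => i _.
rewrite summxE (bigD1 (blade_xor i k)) //= big1 ?addr0.
  by rewrite !mxE blade_xorK !eqxx mulr1.
move=> j jk; rewrite !mxE eqxx /=; case: eqVneq; rewrite ?mulr0// => kE.
by move: jk; rewrite kE blade_xorK eqxx.
Qed.

Lemma Cl21_mulA : associative Cl21_mul.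
Proof.
move=> A B C; apply/rowP => k; rewrite !Cl21_mulE.
under eq_bigr => i _.
  rewrite Cl21_mulE mulr_sumr (reindex_inj (inv_inj (blade_xorK i))) /=.
  over.
rewrite exchange_big /=; apply: eq_bigr => j _.
rewrite Cl21_mulE mulr_sumr mulr_suml; apply: eq_bigr => i _.
rewrite !blade_xorA.
have -> : blade_xor (blade_xor (blade_xor i j) i) k = blade_xor j k.
  by rewrite (blade_xorC _ i) blade_xorK.
have := blade_sign_cocycle i (blade_xor i j) (blade_xor j k).
rewrite blade_xorK.
have -> : blade_xor (blade_xor i j) (blade_xor j k) = blade_xor i k.
  by rewrite -blade_xorA blade_xorK.
by (do 4!case: blade_sign) => //= _; rewrite ?expr0 ?expr1; ring.
Qed.

Lemma Cl21_mul1r : left_id (Cl21_blade (blade false false false)) Cl21_mul.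
Proof.
move=> A; apply/rowP => k; rewrite Cl21_mulE (bigD1 (blade false false false)) //=.
rewrite big1 => [|i /negPf i0]; last by rewrite mxE i0 andbF mulr0 mul0r.
rewrite mxE !eqxx /= addr0 mulr1 /blade_xor !bit_bladeE !addFb bladeK.
by rewrite expr0 mul1r.
Qed.

Lemma Cl21_mulr1 : right_id (Cl21_blade (blade false false false)) Cl21_mul.
Proof.
move=> A; apply/rowP => k.
have xkk : blade_xor k k = blade false false false.
  by rewrite /blade_xor !addbb.
rewrite Cl21_mulE (bigD1 k) //= big1 => [|i ik].
  rewrite xkk mxE !eqxx /= mulr1 addr0 /blade_sign !bit_bladeE !andbF.
  by rewrite expr0 mul1r.
rewrite mxE; case: (eqVneq (blade_xor i k)) => [xik|_]; last by rewrite andbF mulr0.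
move: ik; rewrite eq_sym -(inj_eq (inv_inj (blade_xorK i))) xik.
by rewrite /blade_xor !addbb eqxx.
Qed.

Lemma Cl21_mulDl : left_distributive Cl21_mul +%R.
Proof.
move=> A B C; apply/rowP => k; rewrite mxE !Cl21_mulE -big_split.
by apply: eq_bigr => i _; rewrite !mxE mulrDr mulrDl.
Qed.

Lemma Cl21_mulDr : right_distributive Cl21_mul +%R.
Proof.
move=> A B C; apply/rowP => k; rewrite mxE !Cl21_mulE -big_split.
by apply: eq_bigr => i _; rewrite !mxE mulrDr.
Qed.

Lemma Cl21_oner_neq0 : Cl21_blade (blade false false false) != 0.
Proof.
apply/eqP => /rowP /(_ (blade false false false)) /eqP.
by rewrite !mxE !eqxx oner_eq0.
Qed.

HB.instance Definition _ := GRing.Zmodule_isNzRing.Build (Cl21 R)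
  Cl21_mulA Cl21_mul1r Cl21_mulr1 Cl21_mulDl Cl21_mulDr Cl21_oner_neq0.

Lemma coef_mul_Cl21 A B (k : 'I_8) : (A * B) 0 k = \sum_(i < 8)
  (-1) ^+ blade_sign i (blade_xor i k) * A 0 i * B 0 (blade_xor i k).
Proof. exact: Cl21_mulE. Qed.

Lemma Cl21_scalerAl (a : R) A B : a *: (A * B) = a *: A * B.
Proof.
apply/rowP => k; rewrite mxE !coef_mul_Cl21 mulr_sumr.
by apply: eq_bigr => i _; rewrite !mxE; ring.
Qed.

HB.instance Definition _ :=
  GRing.Lmodule_isLalgebra.Build R (Cl21 R) Cl21_scalerAl.

Lemma Cl21_scalerAr (a : R) A B : a *: (A * B) = A * (a *: B).
Proof.
apply/rowP => k; rewrite mxE !coef_mul_Cl21 mulr_sumr.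
by apply: eq_bigr => i _; rewrite !mxE; ring.
Qed.

HB.instance Definition _ :=
  GRing.Lalgebra_isAlgebra.Build R (Cl21 R) Cl21_scalerAr.

Definition e1 : Cl21 R := Cl21_blade (blade true false false).
Definition e2 : Cl21 R := Cl21_blade (blade false true false).
Definition e3 : Cl21 R := Cl21_blade (blade false false true).

Definition e12 : Cl21 R := e1 * e2.
Definition e13 : Cl21 R := e1 * e3.
Definition e23 : Cl21 R := e2 * e3.
Definition e123 : Cl21 R := e1 * e2 * e3.

Lemma Cl21_blade_mul (i j : 'I_8) :
  Cl21_blade i * Cl21_blade j =
  (-1) ^+ blade_sign i j *: Cl21_blade (blade_xor i j).
Proof.
rewrite -[LHS]/(Cl21_mul _ _) /Cl21_mul (bigD1 i) //= [X in _ + X]big1 ?addr0.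
  rewrite (bigD1 j) //= big1 ?addr0 => [|k /negPf kj].
    by rewrite !mxE !eqxx !mulr1.
  by rewrite !mxE kj andbF mulr0 scale0r.
move=> k /negPf ki; rewrite big1 // => l _.
by rewrite !mxE ki andbF mulr0 mul0r scale0r.
Qed.

Lemma Cl21_bladeE (a b c : bool) :
  Cl21_blade (blade a b c) = e1 ^+ a * e2 ^+ b * e3 ^+ c.
Proof.
case: a; case: b; case: c;
  rewrite ?expr0 ?expr1 ?mul1r ?mulr1 // !Cl21_blade_mul /blade_sign;
  by rewrite /blade_xor !bit_bladeE ?scale1r ?expr0 ?scale1r
     ?Cl21_blade_mul /blade_sign /blade_xor ?bit_bladeE ?expr0 ?scale1r.
Qed.

Lemma e1_sqr : e1 ^+ 2 = 1.
Proof.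
by rewrite expr2 Cl21_blade_mul /blade_sign /blade_xor !bit_bladeE scale1r.
Qed.

Lemma e2_sqr : e2 ^+ 2 = 1.
Proof.
by rewrite expr2 Cl21_blade_mul /blade_sign /blade_xor !bit_bladeE scale1r.
Qed.

Lemma e3_sqr : e3 ^+ 2 = -1.
Proof.
by rewrite expr2 Cl21_blade_mul /blade_sign /blade_xor !bit_bladeE scaleN1r.
Qed.

Lemma e1e2_anticomm : e1 * e2 + e2 * e1 = 0.
Proof.
rewrite !Cl21_blade_mul /blade_sign /blade_xor !bit_bladeE /=.
by rewrite expr0 expr1 scale1r scaleN1r subrr.
Qed.

Lemma e1e3_anticomm : e1 * e3 + e3 * e1 = 0.
Proof.
rewrite !Cl21_blade_mul /blade_sign /blade_xor !bit_bladeE /=.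
by rewrite expr0 expr1 scale1r scaleN1r subrr.
Qed.

Lemma e2e3_anticomm : e2 * e3 + e3 * e2 = 0.
Proof.
rewrite !Cl21_blade_mul /blade_sign /blade_xor !bit_bladeE /=.
by rewrite expr0 expr1 scale1r scaleN1r subrr.
Qed.

Lemma Cl21_basis :
  basis_of fullv ([:: 1; e1; e2; e3; e12; e13; e23; e123] : seq (Cl21 R)).
Proof.
rewrite basisEdim dimvf.
apply/andP; split; last by [].
apply/subvP => A _; rewrite [A]row_sum_delta; apply: memv_suml => i _.
apply: memvZ; rewrite -[delta_mx 0 i]/(Cl21_blade i).
rewrite -(bladeK i) Cl21_bladeE.
case: (bit1 i) (bit2 i) (bit3 i) => [] [] [];
  rewrite ?expr0 ?expr1 ?mul1r ?mulr1; apply: memv_span;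
  by rewrite !inE eqxx ?orbT.
Qed.

Definition Cl21_exp_coeff A : (Cl21 R)^nat := fun k => k`!%:R^-1 *: A ^+ k.

Definition Cl21_exp A : Cl21 R := limn (series (Cl21_exp_coeff A)).

End Cl21_algebra.

Arguments e1 {R}.
Arguments e2 {R}.
Arguments e3 {R}.
Arguments e12 {R}.
Arguments e13 {R}.
Arguments e23 {R}.
Arguments e123 {R}.

Section si_co.
Variable R : realType.
Implicit Type x : R.

Definition sinh x : R := (expR x - expR (- x)) / 2.

Definition cosh x : R := (expR x + expR (- x)) / 2.

Definition si x : R :=
  if 0 < x then sinh (Num.sqrt x) / Num.sqrt x
  else if x < 0 then sin (Num.sqrt (- x)) / Num.sqrt (- x)
  else 1.

Definition co x : R :=
  if 0 < x then cosh (Num.sqrt x)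
  else if x < 0 then cos (Num.sqrt (- x))
  else 1.

End si_co.

(* Main.v *)
Require Import Defs.
From mathcomp Require Import all_boot all_order all_algebra.
From mathcomp Require Import all_classical all_reals all_analysis.
From mathcomp Require Import ring lra.
Set Implicit Arguments.
Unset Strict Implicit.
Unset Printing Implicit Defensive.
Import Order.TTheory GRing.Theory Num.Theory.
Import numFieldNormedType.Exports.
Local Open Scope classical_set_scope.
Local Open Scope ring_scope.

(* The pseudoscalar I is central with I^2 = 1, so p = (1 + I) / 2 and
   p' = (1 - I) / 2 are central idempotents of sum 1.  On the ideal generated by
   p, where I acts as 1, A acts as l + v with l = a0 + a123 real and v a vector of
   square q = a_+^2; on that of p', where I acts as -1, signs change and the square
   is a_-^2.  Hence A^k p = x_k p + y_k v p for real sequences obeying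
   x_(k+1) = l x_k + q y_k and y_(k+1) = x_k + l y_k.  Their exponential generating
   functions solve f' = l f + q g, g' = f + l g, as do e^(l t) co(q t^2) and
   e^(l t) t si(q t^2), and both pairs start at (1, 0), so they agree; take t = 1. *)

(** * Exponential generating functions of real sequences *)

Section exponential_generating_function.
Variable R : realType.
Implicit Types (u : R^nat) (x C M : R).

Definition egf_coeff u : R^nat := fun k => u k / k`!%:R.
Definition egf u x : R := limn (pseries (egf_coeff u) x).

(** This growth condition gives convergence at every [x] by comparison with
    [C * exp_coeff (M * |x|)]. *)
Definition geometrically_bounded u :=
  exists C M, forall k, `|u k| <= C * M ^+ k.

Lemma geometrically_bounded_shift u :
  geometrically_bounded u -> geometrically_bounded (fun k => u k.+1).
Proof.
by move=> [C [M uCM]]; exists (C * M), M => k; rewrite -mulrA -exprS.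
Qed.

Lemma is_cvg_egf u x :
  geometrically_bounded u -> cvgn (pseries (egf_coeff u) x).
Proof.
move=> [C [M uCM]]; apply: normed_cvg.
apply: (@series_le_cvg _ _ (fun k => C * exp_coeff (M * `|x|) k)) => [k|k|k|].
- exact: normr_ge0.
- rewrite /exp_coeff /= exprMn 2!mulrA divr_ge0 // mulr_ge0 ?exprn_ge0 //.
  (* [C * M ^+ k] is nonnegative because it bounds an absolute value. *)
  exact: le_trans (uCM k).
- rewrite /egf_coeff /exp_coeff /= !normrM normfV normrX normr_nat exprMn.
  by rewrite 2!mulrA mulrAC ler_wpM2r ?invr_ge0 // ler_wpM2r ?exprn_ge0.
- exact/is_cvg_seriesZ/is_cvg_series_exp_coeff.
Qed.

(** Since [(k+1) / (k+1)! = 1 / k!], differentiating the series shifts the sequence. *)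
Lemma pseries_diffs_egf_coeff u :
  pseries_diffs (egf_coeff u) = egf_coeff (fun k => u k.+1).
Proof.
apply/funext => k; rewrite /pseries_diffs /egf_coeff factS natrM.
by rewrite invfM mulrCA [_%:R * _]mulrA divff ?mul1r.
Qed.

Lemma is_derive_egf u x : geometrically_bounded u ->
  is_derive x (1 : R) (egf u) (egf (fun k => u k.+1) x).
Proof.
move=> bu; rewrite /egf -pseries_diffs_egf_coeff.
have bu1 := geometrically_bounded_shift bu.
have bu2 := geometrically_bounded_shift bu1.
(* Termwise differentiation asks for convergence of the series and its first two derived series at a
   point of modulus larger than [|x|]. *)
apply: (@pseries_snd_diffs _ _ (`|x| + 1)).
- exact: is_cvg_egf.
- by rewrite pseries_diffs_egf_coeff; exact: is_cvg_egf.
- by rewrite !pseries_diffs_egf_coeff; exact: is_cvg_egf.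
by rewrite [ltRHS]ger0_norm ?addr_ge0 // ltrDl.
Qed.

Lemma egf0 u : egf u 0 = u 0%N.
Proof.
(* The shift drops the empty partial sum, which is 0; all later ones equal [u 0]. *)
apply/cvg_lim => //; rewrite -cvg_shiftS /=.
rewrite (_ : (fun n => _) = fun=> u 0%N); first exact: cvg_cst.
apply/funext => n; rewrite /pseries /series /= big_nat_recl //= big1 ?addr0.
  by rewrite expr0 mulr1 /egf_coeff divr1.
by move=> i _; rewrite expr0n mulr0.
Qed.

Lemma egf_lin (a b : R) u v x :
  geometrically_bounded u -> geometrically_bounded v ->
  egf (fun k => a * u k + b * v k) x = a * egf u x + b * egf v x.
Proof.
move=> bu bv; apply/cvg_lim => //.
rewrite (_ : pseries _ _ = fun n =>
  a * pseries (egf_coeff u) x n + b * pseries (egf_coeff v) x n).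
  by apply: cvgD; apply: cvgMr; exact: is_cvg_egf.
apply/funext => n; rewrite /pseries /series /= !mulr_sumr -big_split.
by apply: eq_bigr => k _; rewrite /egf_coeff /=; ring.
Qed.

End exponential_generating_function.

(** * The linear recurrence for powers and its differential system *)

Section power_coefficients.
Variables (R : realType) (l q : R).

(* [(l + v) ^ k = xcoef k + ycoef k * v] as soon as [v ^ 2 = q]. *)
Definition pow_coef (k : nat) : R * R :=
  iter k (fun z => (l * z.1 + q * z.2, z.1 + l * z.2)) (1, 0).
Definition xcoef k := (pow_coef k).1.
Definition ycoef k := (pow_coef k).2.

Lemma xcoefS k : xcoef k.+1 = l * xcoef k + q * ycoef k.
Proof. by []. Qed.

Lemma ycoefS k : ycoef k.+1 = xcoef k + l * ycoef k.
Proof. by []. Qed.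

(** One step multiplies a common bound on both coefficients by at most [|l| + |q|] for the first and
    [1 + |l|] for the second. *)
Lemma pow_coef_le k :
  `|xcoef k| <= (1 + `|l| + `|q|) ^+ k /\ `|ycoef k| <= (1 + `|l| + `|q|) ^+ k.
Proof.
elim: k => [|k [IHx IHy]]; first by rewrite normr1 normr0 ler01 expr0.
rewrite xcoefS ycoefS exprS; set M := _ ^+ k in IHx IHy *.
have M0 : 0 <= M by apply: le_trans IHx.
have lx := ler_wpM2l (normr_ge0 l) IHx; have ly := ler_wpM2l (normr_ge0 l) IHy.
have qy := ler_wpM2l (normr_ge0 q) IHy.
have qM : 0 <= `|q| * M by rewrite mulr_ge0.
split; rewrite (le_trans (ler_normD _ _)) // ?normrM !mulrDl mul1r; lra.
Qed.

Lemma xcoef_bounded : geometrically_bounded xcoef.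
Proof. by exists 1, (1 + `|l| + `|q|) => k; rewrite mul1r; case: (pow_coef_le k). Qed.

Lemma ycoef_bounded : geometrically_bounded ycoef.
Proof. by exists 1, (1 + `|l| + `|q|) => k; rewrite mul1r; case: (pow_coef_le k). Qed.

Lemma is_derive_egf_xcoef t :
  is_derive t (1 : R) (egf xcoef) (l * egf xcoef t + q * egf ycoef t).
Proof.
rewrite -egf_lin; [|exact: xcoef_bounded|exact: ycoef_bounded].
exact/is_derive_egf/xcoef_bounded.
Qed.

Lemma is_derive_egf_ycoef t :
  is_derive t (1 : R) (egf ycoef) (egf xcoef t + l * egf ycoef t).
Proof.
rewrite -[egf xcoef t]mul1r -egf_lin; [|exact: xcoef_bounded|exact: ycoef_bounded].
rewrite (_ : (fun k => _) = fun k => ycoef k.+1).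
  exact/is_derive_egf/ycoef_bounded.
by apply/funext => k; rewrite ycoefS mul1r.
Qed.

(* [c t] and [s t] stand for [co (q t^2)] and [t si (q t^2)]. *)
Variables c s : R -> R.
Hypothesis c0 : c 0 = 1.
Hypothesis s0 : s 0 = 0.
Hypothesis dc : forall t, is_derive t (1 : R) c (q * s t).
Hypothesis ds : forall t, is_derive t (1 : R) s (c t).

Lemma pythagoras t : c t ^+ 2 - q * s t ^+ 2 = 1.
Proof.
pose F t := c t ^+ 2 - q * s t ^+ 2.
have -> : 1 = F 0 by rewrite /F c0 s0; ring.
apply: (@is_derive_0_is_cst _ F) => x; rewrite /F.
have dcx := dc x; have dsx := ds x.
apply: trigger_derive.
by rewrite /GRing.scale /=; ring.
Qed.

Let fwd (t : R) := expR (- l * t).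

Let dfwd t : is_derive t (1 : R) fwd (- l * fwd t).
Proof.
rewrite /fwd.
apply: trigger_derive; rewrite /GRing.scale /=; ring.
Qed.

(** With [v^2 = q], [U] and [V] are the two components of [e^(-l t) (f + g v) (c - s v) = 1], whose
    left side has zero derivative. *)
Lemma egf_xycoef t :
  egf xcoef t = expR (l * t) * c t /\ egf ycoef t = expR (l * t) * s t.
Proof.
set f := egf xcoef; set g := egf ycoef.
have U : fwd t * (f t * c t - q * (g t * s t)) = 1.
  pose F t := fwd t * (f t * c t - q * (g t * s t)).
  have -> : 1 = F 0.
    by rewrite /F /fwd /f /g !egf0 c0 s0 mulr0 expR0 /xcoef /=; ring.
  apply: (@is_derive_0_is_cst _ F) => x; rewrite /F.
  have dcx := dc x; have dsx := ds x; have dfx := dfwd x.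
  have dX := is_derive_egf_xcoef x; have dY := is_derive_egf_ycoef x.
  apply: trigger_derive.
  by rewrite /GRing.scale /= -/f -/g; ring.
have V : fwd t * (g t * c t - f t * s t) = 0.
  pose F t := fwd t * (g t * c t - f t * s t).
  have -> : 0 = F 0.
    by rewrite /F /fwd /f /g !egf0 c0 s0 /ycoef /=; ring.
  apply: (@is_derive_0_is_cst _ F) => x; rewrite /F.
  have dcx := dc x; have dsx := ds x; have dfx := dfwd x.
  have dX := is_derive_egf_xcoef x; have dY := is_derive_egf_ycoef x.
  apply: trigger_derive.
  by rewrite /GRing.scale /= -/f -/g; ring.
have P := pythagoras t.
have E : expR (l * t) * fwd t = 1.
  by rewrite /fwd mulNr expRxMexpNx_1.
split.
(* Multiplying by [c + s v], the inverse of [c - s v] by [pythagoras], recovers [f] and [g]. *)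
- transitivity (expR (l * t) * fwd t * (f t * (c t ^+ 2 - q * s t ^+ 2))).
    by rewrite E P mulr1 mul1r.
  transitivity (expR (l * t) * (c t * (fwd t * (f t * c t - q * (g t * s t)))
     + q * s t * (fwd t * (g t * c t - f t * s t)))).
    by ring.
  by rewrite U V; ring.
- transitivity (expR (l * t) * fwd t * (g t * (c t ^+ 2 - q * s t ^+ 2))).
    by rewrite E P mulr1 mul1r.
  transitivity (expR (l * t) * (s t * (fwd t * (f t * c t - q * (g t * s t)))
     + c t * (fwd t * (g t * c t - f t * s t)))).
    by ring.
  by rewrite U V; ring.
Qed.

End power_coefficients.

(** * Evaluation at 1 in terms of [co] and [si] *)

Lemma egf_xycoef1 (R : realType) (l q : R) :
  egf (xcoef l q) 1 = expR l * co q /\ egf (ycoef l q) 1 = expR l * si q.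
Proof.
suff [c [s [c0 s0 dc ds [<- <-]]]] : exists c s : R -> R,
    [/\ c 0 = 1, s 0 = 0, forall t, is_derive t (1 : R) c (q * s t),
        forall t, is_derive t (1 : R) s (c t) & c 1 = co q /\ s 1 = si q].
  by rewrite -[in expR l](mulr1 l); exact: egf_xycoef.
(* For fixed [q] the sign of [q t^2] is settled, so each case has one smooth pair: [cosh (w t)] and
   [sinh (w t) / w], their trigonometric analogues, or [1] and [t]. *)
case: (ltrgtP 0 q) => q0.
- pose w := Num.sqrt q.
  have w0 : w != 0 by rewrite gt_eqF // sqrtr_gt0.
  have qE : q = w ^+ 2 by rewrite sqr_sqrtr // ltW.
  exists (fun t => (expR (w * t) + expR (- w * t)) / 2),
         (fun t => (expR (w * t) - expR (- w * t)) / 2 / w).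
  split; rewrite ?mulr0 ?expR0 ?subrr ?mul0r //.
  + by rewrite -[1 + 1]/(2%:R) divff ?pnatr_eq0.
  + move=> t; apply: trigger_derive; rewrite /GRing.scale /= {1}qE; by field.
  + move=> t; apply: trigger_derive; rewrite /GRing.scale /=; by field.
  + by rewrite /co /si q0 /sinh /cosh !mulr1 -/w.
- pose w := Num.sqrt (- q).
  have w0 : w != 0 by rewrite gt_eqF // sqrtr_gt0 oppr_gt0.
  have qE : q = - w ^+ 2 by rewrite sqr_sqrtr ?opprK // oppr_ge0 ltW.
  exists (fun t => cos (w * t)), (fun t => sin (w * t) / w).
  split; rewrite ?mulr0 ?cos0 ?sin0 ?mul0r //.
  + move=> t; apply: trigger_derive; rewrite /GRing.scale /= {1}qE; by field.
  + move=> t; apply: trigger_derive; rewrite /GRing.scale /=; by field.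
  + by rewrite /co /si q0 !mulr1 -/w ltNge ltW.
- subst q; exists (fun=> 1), id; split=> //.
  + by move=> t; rewrite mul0r; exact: is_derive_cst.
  + by move=> t; exact: is_derive_id.
  + by rewrite /co /si ltxx.
Qed.

Lemma cvg_egf1 (R : realType) (u : R^nat) : geometrically_bounded u ->
  series (fun k => k`!%:R^-1 * u k) @ \oo --> egf u 1.
Proof.
move=> bu; have -> : (fun k => k`!%:R^-1 * u k) = fun k => egf_coeff u k * 1 ^+ k.
  by apply/funext => k; rewrite expr1n mulr1 mulrC.
exact: (@is_cvg_egf _ u 1 bu).
Qed.

(** * The exponential series on the two ideals of the algebra *)

Section Cl21_exponential.
Variable R : realType.
Implicit Types A p u : Cl21 R.

(** Left multiplication by [A] preserves the span of [p] and [u] and acts on coordinates by the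
    recurrence of [pow_coef]. *)
Lemma expr_mul_pow_coef A p u (l q : R) (k : nat) :
    A * p = l *: p + u -> A * u = q *: p + l *: u ->
  A ^+ k * p = xcoef l q k *: p + ycoef l q k *: u.
Proof.
move=> Ap Au; elim: k => [|k IH]; first by rewrite mul1r scale1r scale0r addr0.
rewrite exprS -mulrA IH mulrDr -!scalerAr Ap Au xcoefS ycoefS.
rewrite !scalerDr !scalerA addrACA -!scalerDl.
by rewrite [l * xcoef _ _ _]mulrC [l * ycoef _ _ _]mulrC [q * _]mulrC.
Qed.

Lemma cvg_series_scale (f : R^nat) (a : R) (B : Cl21 R) :
  series f @ \oo --> a -> series (fun k => f k *: B) @ \oo --> a *: B.
Proof.
move=> fa; rewrite (_ : series _ = fun n => series f n *: B).
  exact: cvgZr_tmp.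
by apply/funext => n; rewrite /series /= scaler_suml.
Qed.

Lemma cvg_series_exp_mul A p u (l q : R) :
    A * p = l *: p + u -> A * u = q *: p + l *: u ->
  series (fun k => Cl21_exp_coeff A k * p) @ \oo -->
    expR l *: (co q *: p + si q *: u).
Proof.
move=> Ap Au; rewrite scalerDr !scalerA.
have [<- <-] := egf_xycoef1 l q.
rewrite (_ : (fun k => _) = (fun k => (k`!%:R^-1 * xcoef l q k) *: p) +
                            (fun k => (k`!%:R^-1 * ycoef l q k) *: u)).
  rewrite seriesD.
  apply: cvgD; apply: cvg_series_scale; apply: cvg_egf1.
    exact: xcoef_bounded.
  exact: ycoef_bounded.
apply/funext => k; rewrite /Cl21_exp_coeff -scalerAl (expr_mul_pow_coef k Ap Au).
by rewrite scalerDr !scalerA.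
Qed.

Definition multivector (s : seq R) : Cl21 R := \row_i s`_i.

(** This reduces identities in the algebra to eight coordinates; in bit mask order [c12] precedes
    [c3]. *)
Lemma multivectorE (c0 c1 c2 c12 c3 c13 c23 c123 : R) :
  c0 *: 1 + c1 *: e1 + c2 *: e2 + c3 *: e3
    + c12 *: e12 + c13 *: e13 + c23 *: e23 + c123 *: e123 =
  multivector [:: c0; c1; c2; c12; c3; c13; c23; c123].
Proof.
rewrite /e123 /e12 /e13 /e23 /e1 /e2 /e3 -[1]/(Cl21_blade R (blade false false false)).
rewrite !Cl21_blade_mul /blade_sign /blade_xor !bit_bladeE /= !scale1r.
(* The second pass multiplies [e1 * e2], now a single blade, by [e3]. *)
rewrite !Cl21_blade_mul /blade_sign /blade_xor !bit_bladeE /= !scale1r.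
apply/rowP => i; rewrite !mxE /=.
by case: i => [[|[|[|[|[|[|[|[|//]]]]]]]] ?] /=;
  rewrite ?mulr1 ?mulr0 ?addr0 ?add0r.
Qed.


(* The central idempotent [(1 + I) / 2] or [(1 - I) / 2]; the coefficients of a
   multivector follow the bit masks: 1, e1, e2, e12, e3, e13, e23, I. *)
Definition idem (b : bool) : Cl21 R :=
  multivector [:: 2^-1; 0; 0; 0; 0; 0; 0; (-1) ^+ b / 2].

(* [(x1 e1 + x2 e2 + x3 e3) * idem b] *)
Definition idem_vector (b : bool) (x1 x2 x3 : R) : Cl21 R :=
  multivector [:: 0; x1 / 2; x2 / 2; - (-1) ^+ b * x3 / 2; x3 / 2;
                  - (-1) ^+ b * x2 / 2; (-1) ^+ b * x1 / 2; 0].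

Lemma idemD : idem false + idem true = 1.
Proof.
rewrite -[1]/(Cl21_blade R (blade false false false)).
apply/rowP => i; rewrite !mxE.
by case: i => [[|[|[|[|[|[|[|[|//]]]]]]]] ?] /=; field.
Qed.

Section components.
Variables (a0 a1 a2 a3 a12 a13 a23 a123 : R) (b : bool).
Let A := multivector [:: a0; a1; a2; a12; a3; a13; a23; a123].
Let s : R := (-1) ^+ b.
Let x1 := a1 + s * a23.
Let x2 := a2 - s * a13.
Let x3 := a3 - s * a12.

(** As [e23 = e1 I], [e13 = - e2 I], [e12 = - e3 I] and [I] acts as [s] on this ideal, the bivector
    coefficients merge into [x1], [x2], [x3]. *)
Lemma multivector_mul_idem :
  A * idem b = (a0 + s * a123) *: idem b + idem_vector b x1 x2 x3.
Proof.
apply/rowP => i; rewrite coef_mul_Cl21 !big_ord_recl big_ord0.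
rewrite /x1 /x2 /x3 /s.
by case: i => [[|[|[|[|[|[|[|[|//]]]]]]]] ?];
  rewrite !mxE /= /blade_sign /bit1 /bit2 /bit3 /=; case: b; field.
Qed.

(** The vector [x1 e1 + x2 e2 + x3 e3] squares to the scalar [x1^2 + x2^2 - x3^2], by the
    signature. *)
Lemma multivector_mul_idem_vector :
  A * idem_vector b x1 x2 x3 =
  (- x3 ^+ 2 + x2 ^+ 2 + x1 ^+ 2) *: idem b
    + (a0 + s * a123) *: idem_vector b x1 x2 x3.
Proof.
apply/rowP => i; rewrite coef_mul_Cl21 !big_ord_recl big_ord0.
rewrite /x1 /x2 /x3 /s.
by case: i => [[|[|[|[|[|[|[|[|//]]]]]]]] ?];
  rewrite !mxE /= /blade_sign /bit1 /bit2 /bit3 /=; case: b; field.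
Qed.

End components.

End Cl21_exponential.

Theorem theorem5p1 (R : realType) (a0 a1 a2 a3 a12 a13 a23 a123 : R) :
  let A : Cl21 R :=
    a0 *: 1 + a1 *: e1 + a2 *: e2 + a3 *: e3
    + a12 *: e12 + a13 *: e13 + a23 *: e23 + a123 *: e123 in
  let ap2 : R := - (a3 - a12) ^+ 2 + (a2 - a13) ^+ 2 + (a1 + a23) ^+ 2 in
  let am2 : R := - (a3 + a12) ^+ 2 + (a2 + a13) ^+ 2 + (a1 - a23) ^+ 2 in
  let b0 : R := 2^-1 * expR a0 *
    (expR a123 * co ap2 + expR (- a123) * co am2) in
  let b123 : R := 2^-1 * expR a0 *
    (expR a123 * co ap2 - expR (- a123) * co am2) in
  let b1 : R := 2^-1 * expR a0 *
    (expR a123 * (a1 + a23) * si ap2 + expR (- a123) * (a1 - a23) * si am2) in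
  let b2 : R := 2^-1 * expR a0 *
    (expR a123 * (a2 - a13) * si ap2 + expR (- a123) * (a2 + a13) * si am2) in
  let b3 : R := 2^-1 * expR a0 *
    (expR a123 * (a3 - a12) * si ap2 + expR (- a123) * (a3 + a12) * si am2) in
  let b12 : R := 2^-1 * expR a0 *
    (- expR a123 * (a3 - a12) * si ap2 + expR (- a123) * (a3 + a12) * si am2) in
  let b13 : R := 2^-1 * expR a0 *
    (- expR a123 * (a2 - a13) * si ap2 + expR (- a123) * (a2 + a13) * si am2) in
  let b23 : R := 2^-1 * expR a0 *
    (expR a123 * (a1 + a23) * si ap2 - expR (- a123) * (a1 - a23) * si am2) in
  cvgn (series (Cl21_exp_coeff A)) /\
  Cl21_exp A =
    b0 *: 1 + b1 *: e1 + b2 *: e2 + b3 *: e3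
    + b12 *: e12 + b13 *: e13 + b23 *: e23 + b123 *: e123.
Proof.
move=> A ap2 am2 b0 b123 b1 b2 b3 b12 b13 b23.
have cvg_idem b :=
  cvg_series_exp_mul
    (multivector_mul_idem a0 a1 a2 a3 a12 a13 a23 a123 b)
    (multivector_mul_idem_vector a0 a1 a2 a3 a12 a13 a23 a123 b).
rewrite -multivectorE -/A in cvg_idem.
have cvg_exp := cvgD (cvg_idem false) (cvg_idem true).
rewrite -seriesD expr0 expr1 !mul1r !mulN1r !opprK in cvg_exp.
(* The idempotents sum to 1, so adding the two series termwise gives back the exponential series,
   with its convergence and its limit. *)
rewrite (_ : (_ + _) = Cl21_exp_coeff A) in cvg_exp; last first.
  apply/funext => k.
  by rewrite -[RHS]mulr1 -(idemD R) mulrDr.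
rewrite -/ap2 -/am2 in cvg_exp.
have {}cvg_exp := cvg_exp eventually_filter.
split; first exact: cvgP cvg_exp.
rewrite /Cl21_exp (cvg_lim _ cvg_exp) // multivectorE !expRD.
apply/rowP => i; rewrite !mxE /b0 /b1 /b2 /b3 /b12 /b13 /b23 /b123.
by case: i => [[|[|[|[|[|[|[|[|//]]]]]]]] ?] /=; ring.
Qed.
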